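(* For all integers $n\ge 0$, we have $\overline{f}_{\mathrm{BSD}}(n)=f_{\mathrm{HB}}(n-1)$, where $\overline{f}_{\mathrm{BSD}}(n)$ is the number of short binary signed-digit representations of $n$ and $f_{\mathrm{HB}}(m)$ is the number of hyperbinary representations of $m$.
   Context: A binary signed-digit (BSD) representation of an integer $n$ is an expression $n=\sum_{j=0}^{\infty}\epsilon_j 2^j$ with every $\epsilon_j\in\{1,0,-1\}$ and only finitely many $\epsilon_j$ nonzero; representations are identified with their digit sequences $(\epsilon_j)_{j\ge 0}$ (so leading zeros are irrelevant). The leading term is $\epsilon_\ell 2^\ell$, where $\ell$ is the largest index with $\epsilon_\ell\ne 0$. A BSD representation is short if its leading two digits are neither $1,-1$ nor $-1,1$; that is, with $\ell$ the index of the leading term, it is not the case that $\ell\ge 1$ and $(\epsilon_\ell,\epsilon_{\ell-1})\in\{(1,-1),(-1,1)\}$. (A representation with $\ell=0$ is short.) $\overline{f}_{\mathrm{BSD}}(n)$ denotes the number of short BSD representations of $n$. The all-zero expansion of $0$ has no leading term and is not counted as a short BSD representation, so $\overline{f}_{\mathrm{BSD}}(0)=0$. A hyperbinary representation of an integer $m$ is an expression $m=\sum_{j=0}^{\infty}\epsilon_j 2^j$ with every $\epsilon_j\in\{0,1,2\}$ and only finitely many $\epsilon_j$ nonzero, again identified with its digit sequence. $f_{\mathrm{HB}}(m)$ denotes the number of hyperbinary representations of $m$; thus $f_{\mathrm{HB}}(m)=0$ for $m<0$, and $f_{\mathrm{HB}}(0)=1$ (the all-zero expansion is counted). *)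

(* Defs.v *)
From HB Require Import structures.
From mathcomp Require Import all_boot all_order all_algebra.
From mathcomp Require Import finmap.
From mathcomp Require Import boolp classical_sets functions cardinality.

Set Implicit Arguments.
Unset Strict Implicit.
Unset Printing Implicit Defensive.

Import Order.TTheory GRing.Theory Num.Theory.
Local Open Scope ring_scope.
Local Open Scope classical_set_scope.

(* e j is the digit of 2 ^ j, so leading zeros play no role. *)
Definition digits := {fsfun nat -> int with 0}.

Definition value (e : digits) : int := \sum_(j <- finsupp e) e j * 2 ^+ j.

Definition BSD (n : int) : set digits :=
  [set e : digits | (forall j, e j \in [:: 1; 0; -1]) /\ value e = n].

Definition hyperbinary (m : int) : set digits :=
  [set e : digits | (forall j, e j \in [:: 0; 1; 2]) /\ value e = m].

Definition leading_index (e : digits) (l : nat) : Prop :=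
  e l <> 0 /\ forall j, (l < j)%N -> e j = 0.

(* Not satisfied by the all-zero sequence, which has no leading index. *)
Definition short (e : digits) : Prop :=
  exists2 l, leading_index e l &
    ~ ((1 <= l)%N /\
       ((e l = 1 /\ e l.-1 = -1) \/ (e l = -1 /\ e l.-1 = 1))).

Definition short_BSD (n : int) : set digits := BSD n `&` [set e : digits | short e].

(* [fset_set A] is empty when A is infinite, so these two counts are meaningful
   only together with the finiteness of the sets. *)
Definition f_short_BSD (n : int) : nat := #|` fset_set (short_BSD n)|.

Definition f_HB (m : int) : nat := #|` fset_set (hyperbinary m)|.

(* Main.v *)
Require Import Defs.
From mathcomp Require Import all_boot all_order all_algebra.
From mathcomp Require Import finmap.
From mathcomp Require Import boolp classical_sets functions cardinality.
From mathcomp Require Import zify ring lra.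

(** The bijection is digit-wise.  A short BSD representation of [n >= 0] has
    leading digit [1], say at position [l]: a leading [-1] could not be
    compensated by the lower digits.  Subtracting
    [2 ^ l - \sum_(j < l) 2 ^ j = 1] from it amounts to erasing the leading
    digit and adding [1] to each of the [l] digits below, which then lie in
    [{0, 1, 2}].  This gives a hyperbinary representation of [n - 1].

    The number [l] has to be recoverable from that hyperbinary representation,
    and this is exactly what shortness provides: the digit at [l - 1] is not
    [-1], so after the shift it is nonzero and the hyperbinary representation
    has exactly [l] significant digits.  The inverse map [unshift] thus
    subtracts [1] from each significant digit of a hyperbinary representation
    and puts a [1] in front.  It is injective on all digit sequences
    ([unshift_inj]), and its image of the hyperbinary representations of
    [n - 1] is the set of short BSD representations of [n]
    ([short_BSD_unshift]). *)

Set Implicit Arguments.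
Unset Strict Implicit.
Unset Printing Implicit Defensive.

Import Order.TTheory GRing.Theory Num.Theory.
Local Open Scope ring_scope.

Definition of_prefix (N : nat) (f : nat -> int) : digits :=
  [fsfun j in [fset x | x in iota 0 N]%fset => f j].

Lemma of_prefixE N f j : of_prefix N f j = if (j < N)%N then f j else 0.
Proof. by rewrite fsfunE !inE /= mem_iota add0n. Qed.

Definition len (e : digits) : nat := (\max_(j <- finsupp e) j.+1)%N.

Lemma len_ge (e : digits) j : (len e <= j)%N -> e j = 0.
Proof.
move=> le_j; apply/eqP; rewrite -memNfinsupp; apply/negP => je.
have: (j.+1 <= len e)%N by apply: (@leq_bigmax_seq _ _ xpredT succn).
by rewrite leqNgt ltnS le_j.
Qed.

Lemma len_le (e : digits) N : (forall j, (N <= j)%N -> e j = 0) ->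
  (len e <= N)%N.
Proof.
move=> e0; apply/bigmax_leqP_seq => j; rewrite mem_finsupp => ej _.
by rewrite ltnNge; apply: contra ej => /e0 ->.
Qed.

Lemma leading_index_len (e : digits) l : leading_index e l -> len e = l.+1.
Proof.
move=> [el e0]; apply/eqP; rewrite eqn_leq len_le //=.
by rewrite ltnNge; apply/negP => /len_ge.
Qed.

Lemma len_leading_index (e : digits) l : len e = l.+1 -> leading_index e l.
Proof.
move=> le; split=> [el|j lj]; last by apply: len_ge; rewrite le.
have: (len e <= l)%N.
  apply: len_le => j; rewrite leq_eqVlt => /predU1P[<- //|lj].
  by apply: len_ge; rewrite le.
by rewrite le ltnn.
Qed.

Lemma value_widen (e : digits) N : (len e <= N)%N ->
  value e = \sum_(j < N) e j * 2 ^+ j.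
Proof.
move=> leN; rewrite /value -(big_mkord xpredT (fun j => e j * 2 ^+ j)).
rewrite [RHS](bigID (fun j => j \in finsupp e) xpredT) /=.
rewrite [X in _ + X]big1 ?addr0; last first.
  by move=> j; rewrite memNfinsupp => /eqP ->; rewrite mul0r.
rewrite -[RHS]big_filter; apply: perm_big; apply: uniq_perm.
- exact: fset_uniq.
- by rewrite filter_uniq // iota_uniq.
move=> j; rewrite mem_filter mem_index_iota /=.
case je: (j \in finsupp e) => //=; symmetry; rewrite ltnNge.
by apply/negP => /(leq_trans leN) /len_ge /eqP; rewrite -memNfinsupp je.
Qed.

Lemma sum_pow2 N : \sum_(j < N) (2 : int) ^+ j = 2 ^+ N - 1.
Proof. by rewrite subrX1 mul1r. Qed.

Definition unshift (e : digits) : digits :=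
  of_prefix (len e).+1 (fun j => if j == len e then 1 else e j - 1).

Lemma unshift_lt (e : digits) j : (j < len e)%N -> unshift e j = e j - 1.
Proof. by move=> jl; rewrite of_prefixE ltnS (ltnW jl) (ltn_eqF jl). Qed.

Lemma unshift_len (e : digits) : unshift e (len e) = 1.
Proof. by rewrite of_prefixE ltnSn eqxx. Qed.

Lemma unshift_gt (e : digits) j : (len e < j)%N -> unshift e j = 0.
Proof. by move=> lj; rewrite of_prefixE ltnS leqNgt lj. Qed.

Lemma leading_unshift (e : digits) : leading_index (unshift e) (len e).
Proof. by split=> [|j]; [rewrite unshift_len | exact: unshift_gt]. Qed.

Lemma value_unshift (e : digits) : value (unshift e) = value e + 1.
Proof.
rewrite (@value_widen (unshift e) (len e).+1); last first.
  by rewrite (leading_index_len (leading_unshift e)).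
rewrite (value_widen (leqnn _)) big_ord_recr /= unshift_len.
under eq_bigr => j _ do rewrite unshift_lt // mulrBl mul1r.
by rewrite sumrB sum_pow2; ring.
Qed.

(** The length of [e] can be read off [unshift e], because the new leading
    digit is nonzero whatever the digits of [e] are. *)
Lemma unshift_inj : injective unshift.
Proof.
move=> e e' eq_u.
have /eqP : (len e).+1 = (len e').+1.
  by rewrite -(leading_index_len (leading_unshift e)) eq_u (leading_index_len (leading_unshift e')).
rewrite eqSS => /eqP eq_len; apply/fsfunP => j.
have [jl|lj] := ltnP j (len e); last by rewrite !len_ge // -eq_len.
apply: (addIr (-1)).
by rewrite -unshift_lt // eq_u unshift_lt // -eq_len.
Qed.

(** The digits below position [l] contribute at most [2 ^ l - 1], which a
    leading [-1] outweighs. *)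
Lemma BSD_leading_eq1 (n : int) (e : digits) l :
  0 <= n -> BSD n e -> leading_index e l -> e l = 1.
Proof.
move=> n0 [dig val_e] lead; have [el _] := lead.
move: (dig l); rewrite !inE => /or3P[/eqP //|/eqP //|/eqP em1].
have: value e <= -1; last by rewrite val_e; lia.
rewrite (@value_widen e l.+1) ?(leading_index_len lead) // big_ord_recr /= em1.
have: \sum_(j < l) e j * 2 ^+ j <= \sum_(j < l) (2 : int) ^+ j.
  apply: ler_sum => j _; rewrite ler_piMl ?exprn_ge0 //.
  by move: (dig j); rewrite !inE => /or3P[] /eqP ->.
rewrite sum_pow2; lra.
Qed.

Lemma unshift_short_BSD (n : int) (e : digits) :
  hyperbinary (n - 1) e -> short_BSD n (unshift e).
Proof.
move=> [dig val_e]; split.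
  split; last by rewrite value_unshift val_e subrK.
  move=> j; have [jl|jl|->] := ltngtP j (len e).
  - by rewrite unshift_lt //; move: (dig j); rewrite !inE => /or3P[] /eqP ->.
  - by rewrite unshift_gt.
  - by rewrite unshift_len.
exists (len e); first exact: leading_unshift.
rewrite unshift_len => -[]; case le: (len e) => [//|l] _ [[_]|[]] //=.
rewrite unshift_lt ?le //; have [el _] := len_leading_index le.
by move=> /eqP; rewrite subr_eq => /eqP.
Qed.

(** The preimage adds [1] to every digit below the leading [1]; shortness
    makes the topmost of these nonzero, so that [unshift] puts the [1] back
    at the same place. *)
Lemma short_BSD_preimage (n : int) (e : digits) : 0 <= n -> short_BSD n e ->
  exists2 h, hyperbinary (n - 1) h & unshift h = e.
Proof.
move=> n0 [bsd_e [l lead sh]]; have el := BSD_leading_eq1 n0 bsd_e lead.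
have [dig val_e] := bsd_e.
pose h := of_prefix l (fun j => e j + 1).
have len_h : len h = l.
  case: l => [|l] in lead sh el h *.
    by apply/eqP; rewrite -leqn0; apply: len_le => j _; rewrite of_prefixE.
  apply: leading_index_len; split=> [|j lj]; rewrite of_prefixE ?ltnSn; last first.
    by rewrite ltnS leqNgt lj.
  by move=> /eqP; rewrite addr_eq0 => /eqP em1; apply: sh; split=> //; left.
have uh : unshift h = e.
  apply/fsfunP => j; have [jl|jl|->] := ltngtP j (len h).
  - by rewrite unshift_lt // of_prefixE -{1}len_h jl addrK.
  - by rewrite unshift_gt //; case: lead => _ ->; rewrite // -len_h.
  - by rewrite unshift_len len_h el.
exists h => //; split=> [j|]; last by rewrite -val_e -uh value_unshift addrK.
rewrite of_prefixE; case: ifP => // _.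
by move: (dig j); rewrite !inE => /or3P[] /eqP ->.
Qed.

Lemma short_BSD_unshift (n : int) : 0 <= n ->
  short_BSD n = (unshift @` hyperbinary (n - 1))%classic.
Proof.
move=> n0; apply/seteqP; split=> [e /(short_BSD_preimage n0)[h hh <-]|].
  by exists h.
by move=> _ [h hh <-]; apply: unshift_short_BSD.
Qed.

(** A nonzero digit at position [j] contributes at least [2 ^ j > j], and
    nothing is negative. *)
Lemma len_hyperbinary (m : int) (e : digits) :
  hyperbinary m e -> (len e <= `|m|)%N.
Proof.
move=> [dig <-]; case le: (len e) => [//|l].
have [el _] := len_leading_index le.
have dig0 j : 0 <= e j by move: (dig j); rewrite !inE => /or3P[] /eqP ->.
rewrite (value_widen (leqnn _)) le big_ord_recr /=.
have S0 : 0 <= \sum_(j < l) e j * 2 ^+ j.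
  by apply: sumr_ge0 => j _; rewrite mulr_ge0 // exprn_ge0.
have T : (2 : int) ^+ l <= e l * 2 ^+ l.
  rewrite ler_peMl ?exprn_ge0 //.
  by move: el (dig l); rewrite !inE => el0 /or3P[] /eqP E; rewrite E in el0 *.
have P : l.+1%:Z <= 2 ^+ l by rewrite -natrX natz lez_nat ltn_expl.
move: S0 (le_trans P T); move: (\sum_(_ < _) _) (_ * _) => a b; lia.
Qed.

(** Only finitely many positions, a number bounded in terms of [m], can carry
    a nonzero digit, and each digit has three possible values. *)
Lemma finite_hyperbinary (m : int) : finite_set (hyperbinary m).
Proof.
pose N := `|m|%N.
pose g (u : {ffun 'I_N.+1 -> 'I_3}) : digits :=
  of_prefix N (fun j => (u (inord j) : nat)%:Z).
apply: (@sub_finite_set _ _ (g @` [set: _])%classic); last first.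
  by apply: finite_image; apply: finite_finset.
move=> e he; exists [ffun j : 'I_N.+1 => inord `|e j|%N] => //.
apply/fsfunP => j; rewrite of_prefixE; case: ltnP => jN; last first.
  by rewrite len_ge // (leq_trans (len_hyperbinary he)).
rewrite ffunE (inordK (leqW jN)); have [dig _] := he.
by move: (dig j); rewrite !inE => /or3P[] /eqP ->; rewrite inordK.
Qed.

Unset Implicit Arguments.

Theorem theorem1p2 (n : int) (hn : 0 <= n) :
  [/\ finite_set (short_BSD n), finite_set (hyperbinary (n - 1))
    & f_short_BSD n = f_HB (n - 1)].
Proof.
have fin := finite_hyperbinary (n - 1).
rewrite /f_short_BSD /f_HB short_BSD_unshift //; split=> //.
  exact: finite_image.
by rewrite fset_set_image // card_imfset //; apply: unshift_inj.
Qed.
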